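(* Let $\sigma$ be a bounded endomorphism on a Banach algebra $\mathcal{A}$, let $d:\mathcal{A}\to\mathcal{A}$ be a bounded $\sigma$-derivation such that $d\sigma=\sigma d=d$, and let $a\in\mathcal{A}$ satisfy $d^2(a)=0$. Then $d(a)$ is quasinilpotent, i.e. its spectral radius satisfies $r(d(a))=0$.
   Context: An endomorphism of $\mathcal{A}$ is a linear multiplicative map $\mathcal{A}\to\mathcal{A}$. A linear mapping $d:\mathcal{A}\to\mathcal{A}$ is a $\sigma$-derivation if $d(ab)=d(a)\sigma(b)+\sigma(a)d(b)$ for all $a,b\in\mathcal{A}$. The spectral radius is $r(x)=\lim_{n\to\infty}\|x^n\|^{1/n}$. *)

(* Defs.v *)
From HB Require Import structures.
From mathcomp Require Import all_boot all_order all_algebra.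
From mathcomp Require Import all_classical all_reals all_analysis.
From mathcomp Require Import complex.

Set Implicit Arguments.
Unset Strict Implicit.
Unset Printing Implicit Defensive.

Import Order.TTheory GRing.Theory Num.Theory.
Import numFieldNormedType.Exports.

Local Open Scope classical_set_scope.
Local Open Scope ring_scope.

(* No unit is assumed, so the algebra structures of MathComp, which are all
   unital, do not apply. *)
HB.mixin Record CompleteNormedModule_isBanachAlgebra (K : numFieldType) A
    & CompleteNormedModule K A := {
  bmul : A -> A -> A;
  bmulA : associative bmul;
  bmulDl : left_distributive bmul +%R;
  bmulDr : right_distributive bmul +%R;
  bmulZl : forall (k : K) x y, bmul (k *: x) y = k *: bmul x y;
  bmulZr : forall (k : K) x y, bmul x (k *: y) = k *: bmul x y;
  bnormM : forall x y, `|bmul x y| <= `|x| * `|y|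
}.

#[short(type="banachAlgType")]
HB.structure Definition BanachAlgebra (K : numFieldType) :=
  {A of CompleteNormedModule K A & CompleteNormedModule_isBanachAlgebra K A}.

Declare Scope banach_scope.
Notation "x ** y" := (bmul x y) (at level 40, left associativity) : banach_scope.
Local Open Scope banach_scope.

Section Operators.
Context {K : numFieldType} {A : banachAlgType K}.

Definition bounded_operator (f : A -> A) : Prop :=
  exists M : K, forall x, `|f x| <= M * `|x|.

Definition multiplicative_map (sigma : A -> A) : Prop :=
  forall x y, sigma (x ** y) = sigma x ** sigma y.

Definition sigma_derivation (sigma d : A -> A) : Prop :=
  forall x y, d (x ** y) = d x ** sigma y + sigma x ** d y.

(* Without a unit there is no zeroth power: bpowS x n is x ^ (n + 1). *)
Definition bpowS (x : A) (n : nat) : A := iter n (bmul x) x.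

End Operators.

(* Banach algebras over the reals and over the complex numbers are treated
   together: the scalar field is R or R[i]. *)
Variant scalar_kind := RealScalars | ComplexScalars.

Definition scalars (R : realType) (k : scalar_kind) : numFieldType :=
  match k with
  | RealScalars => R
  | ComplexScalars => R[i]
  end.

(* The norm of a normed module over K takes its values in K, hence in R[i] for
   complex scalars; these values are real and are read back in R. *)
Definition scalar_re (R : realType) (k : scalar_kind) : scalars R k -> R :=
  match k with
  | RealScalars => fun z : R => z
  | ComplexScalars => fun z : R[i] => complex.Re z
  end.

Section SpectralRadius.
Context {R : realType} {k : scalar_kind} {A : banachAlgType (scalars R k)}.

Definition rnorm (x : A) : R := scalar_re `|x|.

(* Shifted by one: the n-th term is ||x ^ (n + 1)|| ^ (1 / (n + 1)). *)
Definition norm_roots (x : A) : R^nat :=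
  fun n => rnorm (bpowS x n) `^ (n.+1%:R^-1).

Definition spectral_radius (x : A) : R := limn (norm_roots x).

(* A divergent sequence has the junk value 0 as its limn, so convergence is part
   of the definition. *)
Definition quasinilpotent (x : A) : Prop :=
  cvgn (norm_roots x) /\ spectral_radius x = 0.

End SpectralRadius.

(* Main.v *)
(* Put b = d a. Since d b = 0 and sigma b = b, the Leibniz rule degenerates to
   d^n (a y) = sigma^n(a) d^n(y) + n b d^(n-1)(y) for n >= 2. Hence d^n kills
   a^m for n > m, and d^n(a^n) = n! b^n. As d is bounded,
   n! ||b^n|| <= (C ||a||)^n, so ||b^n||^(1/n) tends to 0. *)

Require Import Defs.
From HB Require Import structures.
From mathcomp Require Import all_boot all_order all_algebra.
From mathcomp Require Import all_classical all_reals all_analysis.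
From mathcomp Require Import complex.

Import Order.TTheory GRing.Theory Num.Theory.
Import numFieldNormedType.Exports.
Local Open Scope ring_scope.

Local Open Scope classical_set_scope.
Local Open Scope banach_scope.

Section DerivationPowers.
Context {K : numFieldType} {A : banachAlgType K}.
Variables (sigma d : {linear A -> A}).
Hypothesis d_der : sigma_derivation sigma d.
Hypothesis d_sigma : d \o sigma =1 d.
Hypothesis sigma_d : sigma \o d =1 d.

Let bmul0l (y : A) : 0 ** y = 0.
Proof. by apply: (addrI (0 ** y)); rewrite -bmulDl !addr0. Qed.

Let bmul0r (y : A) : y ** 0 = 0.
Proof. by apply: (addrI (y ** 0)); rewrite -bmulDr !addr0. Qed.

(** Induction on the order: differentiating the [sigma]-term yields one more copy of the product
    with [d a], and the coefficient counts these copies. The order starts at two because the Leibniz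
    rule first leaves [d a ** sigma y], whose [sigma] is absorbed only by a further [d]. *)
Lemma iter_derivation_mul (a y : A) (n : nat) : d (d a) = 0 ->
  iter n.+2 d (a ** y) =
  iter n.+2 sigma a ** iter n.+2 d y + n.+2%:R *: (d a ** iter n.+1 d y).
Proof.
move=> dda; have sdE z : sigma (d z) = d z := sigma_d z.
have dsE z : d (sigma z) = d z := d_sigma z.
have d_da z : d (d a ** z) = d a ** d z by rewrite d_der dda bmul0l add0r sdE.
have d_iter_sigma m : d (iter m sigma a) = d a by elim: m => //= m; rewrite dsE.
elim: n => [|n IHn].
  rewrite /= !d_der linearD /= d_da d_der !dsE sdE scaler_nat mulr2n.
  by rewrite addrA addrC.
rewrite iterS IHn linearD linearZ /= d_der.
rewrite (d_iter_sigma n.+2) d_da sdE addrC addrA -[X in _ + X + _]scale1r -scalerDl.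
by rewrite natr1 addrC.
Qed.

(** Induction on the exponent, which is [m.+1]. Splitting off one factor [a] lowers the exponent by
    one and the order of [d] by at most one, so the order stays above the exponent in both
    summands. *)
Lemma iter_derivation_bpowS_eq0 (a : A) (m n : nat) : d (d a) = 0 ->
  (m.+1 < n)%N -> iter n d (bpowS a m) = 0.
Proof.
move=> dda; elim: m n => [|m IHm] [|[|n]] //.
  by elim: n => [|n IHn] _ //; rewrite iterS IHn ?linear0.
rewrite ltnS => lt_mn.
rewrite [bpowS a m.+1]/(a ** bpowS a m) iter_derivation_mul //.
by rewrite !IHm ?bmul0r ?scaler0 ?addr0 // ltnW.
Qed.

Lemma iter_derivation_bpowS (a : A) (n : nat) : d (d a) = 0 ->
  iter n.+1 d (bpowS a n) = n.+1`!%:R *: bpowS (d a) n.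
Proof.
move=> dda; elim: n => [|n IHn]; first by rewrite /= scale1r.
rewrite [bpowS a n.+1]/(a ** bpowS a n) iter_derivation_mul //.
(* The [sigma]-term applies [d] to [bpowS a n] once more than its exponent [n.+1], so it vanishes;
   the other term supplies the new factor [n.+2] of the factorial. *)
rewrite iter_derivation_bpowS_eq0 // bmul0r add0r IHn bmulZr scalerA.
by rewrite -natrM -factS.
Qed.

Lemma norm_bpowS_le (x : A) (n : nat) : `|bpowS x n| <= `|x| ^+ n.+1.
Proof.
elim: n => [|n IHn]; first by rewrite expr1.
by rewrite exprS (le_trans (bnormM _ _)) // ler_wpM2l.
Qed.

Lemma norm_iter_le (f : A -> A) (C : K) (x : A) (n : nat) : 0 <= C ->
  (forall y, `|f y| <= C * `|y|) -> `|iter n f x| <= C ^+ n * `|x|.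
Proof.
move=> C0 fC; elim: n => [|n IHn]; first by rewrite mul1r.
by rewrite exprS -mulrA (le_trans (fC _)) // ler_wpM2l.
Qed.

Lemma norm_bpowS_derivation_le (a : A) : d (d a) = 0 -> bounded_operator d ->
  exists2 c : K, 0 <= c &
    forall n, `|bpowS (d a) n| * n.+1`!%:R <= c ^+ n.+1.
Proof.
move=> dda [M dM].
(* The bound [M] need not be nonnegative when [A] is zero. In any case the product of [M] with a
   norm dominates a norm, hence equals its own absolute value. *)
have dC y : `|d y| <= `|M| * `|y|.
  have My0 : 0 <= M * `|y| by rewrite (le_trans _ (dM y)).
  by rewrite -[`|y|]normr_id -normrM ger0_norm.
exists (`|M| * `|a|) => [|n]; first by rewrite mulr_ge0.
have -> : `|bpowS (d a) n| * n.+1`!%:R = `|iter n.+1 d (bpowS a n)|.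
  by rewrite iter_derivation_bpowS // normrZ normr_nat mulrC.
rewrite exprMn (le_trans (norm_iter_le _ _ _ _ _ dC)) //.
by rewrite ler_wpM2l ?exprn_ge0 ?norm_bpowS_le.
Qed.

End DerivationPowers.

Section ScalarRe.
Context {R : realType} {k : scalar_kind}.
Implicit Types z c : scalars R k.

Lemma scalar_re_ge0 z : 0 <= z -> 0 <= scalar_re z.
Proof. by case: k z => //= z; rewrite lecE => /andP[]. Qed.

Lemma scalar_re_mulrn_le_exp z c (m n : nat) : 0 <= z -> 0 <= c ->
  z * m%:R <= c ^+ n -> scalar_re z * m%:R <= scalar_re c ^+ n.
Proof.
case: k z c => //= z c z0 c0.
(* The order of [R[i]] only compares numbers with equal imaginary parts, so nonnegative ones are
   real and the inequality descends to [R]. *)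
have real_part (w : R[i]) : 0 <= w -> w = (complex.Re w)%:C%C.
  by case: w => x y; rewrite lecE => /andP[/eqP /= -> _].
rewrite {1}(real_part z z0) {1}(real_part c c0).
by rewrite -(rmorph_nat (real_complex R)) -rmorphM -rmorphXn /= lecR.
Qed.

End ScalarRe.

(** No estimate of the factorial is needed: the terms of the exponential series at [L / e] tend to
    0, and as soon as they are below 1 the bound on [v n] gives [v n <= e ^+ n.+1]. *)
Lemma cvg_roots_factorial_bound (R : realType) (v : R^nat) (L : R) :
  (forall n, 0 <= v n) -> (forall n, v n * n.+1`!%:R <= L ^+ n.+1) ->
  (v n `^ n.+1%:R^-1) @[n --> \oo] --> 0.
Proof.
move=> v0 vL; apply/cvgr0Pnorm_le => e e0.
have : exp_coeff (L / e) n.+1 @[n --> \oo] --> 0.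
  by rewrite (cvg_shiftS (exp_coeff (L / e))); exact: cvg_exp_coeff.
move=> /cvgr0_norm_lt /(_ _ ltr01); apply: filterS => n.
move=> /(le_lt_trans (ler_norm _)); rewrite exp_coeffE /= => lt1.
rewrite ger0_norm ?powR_ge0 //.
have ve : v n <= e ^+ n.+1.
  have f0 : 0 < n.+1`!%:R :> R by rewrite ltr0n fact_gt0.
  have := ltW lt1; rewrite mulrC ler_pdivrMr // mul1r exprMn exprVn.
  rewrite ler_pdivrMr ?exprn_gt0 // mulrC => le_L.
  by rewrite -(ler_pM2r f0) (le_trans (vL n)).
(* Writing [e] as a root of its own power reduces the goal to monotonicity of the root. *)
have -> : e = (e ^+ n.+1) `^ n.+1%:R^-1.
  rewrite -powR_mulrn ?ltW // -powRrM mulfV ?pnatr_eq0 //.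
  by rewrite powRr1 // ltW.
by apply: ge0_ler_powR; rewrite ?nnegrE ?invr_ge0 ?exprn_ge0 // ltW.
Qed.

Theorem theorem3p9 (R : realType) (k : scalar_kind)
    (A : banachAlgType (scalars R k))
    (sigma : {linear A -> A}) (d : {linear A -> A})
    (sigma_mul : multiplicative_map sigma)
    (sigma_bounded : bounded_operator sigma)
    (d_der : sigma_derivation sigma d)
    (d_bounded : bounded_operator d)
    (d_sigma : d \o sigma =1 d)
    (sigma_d : sigma \o d =1 d)
    (a : A) (dda : d (d a) = 0) :
  quasinilpotent (d a).
Proof.
have [c c0 dc] := norm_bpowS_derivation_le _ _ d_der d_sigma sigma_d _ dda d_bounded.
have roots0 : norm_roots (d a) @ \oo --> (0 : R).
  apply: (cvg_roots_factorial_bound _ _ (scalar_re c)) => n.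
    exact/scalar_re_ge0/normr_ge0.
  exact: scalar_re_mulrn_le_exp.
(* The limit 0 yields both the convergence of the roots and the value of [limn]. *)
by split; [apply/cvg_ex; exists 0 | apply: cvg_lim].
Qed.
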